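(* Let $\mathbb{K}$ be a field, $S=\mathbb{K}[x_1,\dots,x_n]$, and let $I\subset S$ be a monomial ideal. Then there exist integers $k_1,k_2\geq 1$ such that for every integer $s\geq 1$, $${\rm sdepth}(I^{sk_1}) \leq {\rm sdepth}(\overline{I})\quad\text{and}\quad {\rm sdepth}(S/I^{sk_2}) \leq {\rm sdepth}(S/\overline{I}).$$
   Context: $S=\mathbb{K}[x_1,\dots,x_n]$ is the polynomial ring over a field $\mathbb{K}$ with its standard $\mathbb{Z}^n$-grading ($\deg x_i=e_i$). Stanley depth: let $M$ be a finitely generated $\mathbb{Z}^n$-graded $S$-module. For a homogeneous element $u\in M$ and a subset $Z\subseteq\{x_1,\dots,x_n\}$, let $u\mathbb{K}[Z]$ be the $\mathbb{K}$-subspace of $M$ generated by all elements $uv$ with $v\in\mathbb{K}[Z]$. It is called a Stanley space of dimension $|Z|$ if it is a free $\mathbb{K}[Z]$-module. A Stanley decomposition $\mathcal{D}$ of $M$ is a decomposition of $M$ (as a $\mathbb{K}$-vector space) as a finite direct sum of Stanley spaces. The Stanley depth ${\rm sdepth}(\mathcal{D})$ is the minimum dimension of a Stanley space in $\mathcal{D}$, and ${\rm sdepth}(M)$ is the maximum of ${\rm sdepth}(\mathcal{D})$ over all Stanley decompositions $\mathcal{D}$ of $M$. Convention: ${\rm sdepth}(0)=\infty$ (empty decomposition). Integral closure: for an ideal $I\subseteq S$, an element $f\in S$ is integral over $I$ if there is an equation $f^m+c_1f^{m-1}+\dots+c_{m-1}f+c_m=0$ with $m\ge 1$ and $c_i\in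 I^i$. The integral closure $\overline{I}$ is the set of all elements of $S$ integral over $I$. For a monomial ideal $I$, it is known that $\overline{I}$ is the monomial ideal generated by all monomials $u\in S$ such that $u^m\in I^m$ for some integer $m\geq 1$. *)

(* Defs.v *)
From HB Require Import structures.
From mathcomp Require Import all_boot all_order all_algebra.
From mathcomp Require Import generic_quotient ring_quotient mpoly boolp.

Set Implicit Arguments.
Unset Strict Implicit.
Unset Printing Implicit Defensive.

Import GRing.Theory.
Local Open Scope ring_scope.
Local Open Scope quotient_scope.

(* An ideal is an R-submodule of R; unlike the library's [idealr], it may be
   the whole ring. *)
Notation ideal R := (submodClosed R^o).

Section GeneratedIdeal.
Variables (R : comNzRingType) (A : R -> Prop).

Definition gen_pred : {pred R^o} := fun f =>
  `[< exists r (c g : 'I_r -> R),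
        (forall j, A (g j)) /\ f = \sum_j c j * g j >].

Lemma gen_predP (f : R) :
  reflect (exists r (c g : 'I_r -> R),
             (forall j, A (g j)) /\ f = \sum_j c j * g j)
          (f \in gen_pred).
Proof. exact: asboolP. Qed.

Lemma gen_pred_closed : submod_closed gen_pred.
Proof.
split=> [|a _ _ /gen_predP[r [c [g [Ag ->]]]] /gen_predP[s [d [h [Ah ->]]]]].
  apply/gen_predP; exists 0%N, (fun=> 0), (fun=> 0); split=> [[]//|].
  by rewrite big_ord0.
apply/gen_predP; exists (r + s)%N,
  (fun j => match split j with inl i => a * c i | inr i => d i end),
  (fun j => match split j with inl i => g i | inr i => h i end); split.
  by move=> j; case: split.
rewrite big_split_ord /= scaler_sumr; congr (_ + _); apply: eq_bigr => i _.
  by rewrite -[lshift s i]/(unsplit (inl i)) unsplitK -mulrA.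
by rewrite -[rshift r i]/(unsplit (inr i)) unsplitK.
Qed.

HB.instance Definition _ := GRing.isSubmodClosed.Build R R^o gen_pred
  gen_pred_closed.

Definition gen_ideal : ideal R := gen_pred.

Lemma gen_ideal_mem g : A g -> g \in gen_ideal.
Proof.
move=> Ag; apply/gen_predP; exists 1%N, (fun=> 1), (fun=> g); split=> //.
by rewrite big_ord1 mul1r.
Qed.

End GeneratedIdeal.

Section IdealTheory.
Variables (R : comNzRingType) (J : ideal R).

Lemma ideal0 : (0 : R) \in J. Proof. exact: (rpred0 J). Qed.

Lemma idealD (f g : R) : f \in J -> g \in J -> f + g \in J.
Proof. by move=> Jf Jg; exact: (@rpredD R^o J f g Jf Jg). Qed.

Lemma idealMl (a f : R) : f \in J -> a * f \in J.
Proof. exact: (@rpredZ R R^o J a f). Qed.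

Lemma idealB (f g : R) : f \in J -> g \in J -> f - g \in J.
Proof. by move=> Jf Jg; rewrite idealD // -mulN1r idealMl. Qed.

Lemma ideal_sum (r : nat) (F : 'I_r -> R) :
  (forall i, F i \in J) -> \sum_i F i \in J.
Proof. by move=> JF; apply: (@rpred_sum R^o J) => i _; apply: JF. Qed.

End IdealTheory.

Section IntegralClosure.
Variables (R : comNzRingType) (I : ideal R).

Definition ideal_pow (k : nat) : ideal R :=
  gen_ideal (fun p => exists g : 'I_k -> R,
                        (forall i, g i \in I) /\ p = \prod_i g i).

Definition integral_over (f : R) : Prop :=
  exists (m : nat) (c : nat -> R),
    [/\ (1 <= m)%N,
        forall i, (1 <= i <= m)%N -> c i \in ideal_pow i
      & f ^+ m + \sum_(1 <= i < m.+1) c i * f ^+ (m - i) = 0].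

Lemma ideal_pow0 (f : R) : f \in ideal_pow 0.
Proof.
rewrite -[f]mulr1; apply: idealMl; apply: gen_ideal_mem.
by exists (fun=> 0); split=> [[]//|]; rewrite big_ord0.
Qed.

Lemma ideal_powM j k (f g : R) :
  f \in ideal_pow j -> g \in ideal_pow k -> f * g \in ideal_pow (j + k).
Proof.
move=> /gen_predP[r [c [u [Pu ->]]]] /gen_predP[s [d [v [Pv ->]]]].
rewrite mulr_suml; apply: ideal_sum => i.
rewrite mulr_sumr; apply: ideal_sum => l.
rewrite mulrACA; apply: idealMl; apply: gen_ideal_mem.
have [x [Ix ->]] := Pu i; have [y [Iy ->]] := Pv l.
exists (fun t => match split t with inl i => x i | inr i => y i end); split.
  by move=> t; case: split.
by rewrite big_split_ord /=; congr (_ * _); apply: eq_bigr => t _;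
  [rewrite -[lshift k t]/(unsplit (inl t)) unsplitK
  |rewrite -[rshift j t]/(unsplit (inr t)) unsplitK].
Qed.

(* The Rees algebra R[I T]: f is integral over I iff f T is integral over it,
   which is why the integral closure is closed under addition. *)
Definition rees : {pred {poly R}} := fun p =>
  `[< forall i, p`_i \in ideal_pow i >].

Lemma reesP (p : {poly R}) :
  reflect (forall i, p`_i \in ideal_pow i) (p \in rees).
Proof. exact: asboolP. Qed.

Lemma rees_closed : subring_closed rees.
Proof.
split=> [|p q /reesP Ip /reesP Iq|p q /reesP Ip /reesP Iq]; apply/reesP=> i.
- by rewrite coef1; case: i => [|i]; [exact: ideal_pow0|exact: ideal0].
- by rewrite coefB; apply: idealB.
- rewrite coefM; apply: ideal_sum => j.
  have := ideal_powM (Ip j) (Iq (i - j)%N).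
  by rewrite subnKC // -ltnS.
Qed.

HB.instance Definition _ := GRing.isSubringClosed.Build {poly R} rees
  rees_closed.

Record rees_type := Rees { rees_val :> {poly R}; _ : rees_val \in rees }.
HB.instance Definition _ := [isSub for rees_val].
HB.instance Definition _ := [Choice of rees_type by <:].
HB.instance Definition _ := [SubChoice_isSubComNzRing of rees_type by <:].

Lemma integral_reesP (f : R) :
  integral_over f <->
  integralOver (val : rees_type -> {poly R}) (f%:P * 'X).
Proof.
split=> [[m [c [m_gt0 Ic eq0]]] | [p mon_p /rootP px0]].
  pose d i := if i == 0%N then 1 else c i.
  have dP i : (i <= m)%N -> (d i)%:P * 'X^i \in rees.
    move=> le_im; apply/reesP=> j; rewrite coefCM coefXn.
    have [->|_] := eqVneq j i; last by rewrite mulr0 ideal0.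
    rewrite mulr1 /d; case: eqP => [->|/eqP]; first exact: ideal_pow0.
    by rewrite -lt0n => i_gt0; apply: Ic; rewrite i_gt0.
  pose e j : rees_type := Rees (dP (m - j)%N (leq_subr _ _)).
  have e1 : e m = 1.
    by apply: val_inj; rewrite /= subnn /d /= expr0 mulr1.
  exists (\poly_(j < m.+1) e j).
    by apply/monicP; rewrite lead_coef_poly //= e1 ?oner_neq0.
  apply/rootP; rewrite (@horner_coef_wide _ m.+1); last first.
    by rewrite (leq_trans (size_poly _ _)) // size_poly.
  transitivity ('X^m * (\sum_(j < m.+1) d (m - j)%N * f ^+ j)%:P : {poly R}).
    rewrite rmorph_sum mulr_sumr; apply: eq_bigr => j _.
    have -> : 'X^m = 'X^(m - j) * 'X^j :> {poly R}.
      by rewrite -exprD subnK // -ltnS.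
    by rewrite coef_map coef_poly ltn_ord /= exprMn mulrACA mulrC polyCM rmorphXn.
  rewrite [X in X%:P](_ : _ = 0) ?mulr0 // -[RHS]eq0 big_ord_recr /= subnn /d /=.
  rewrite mul1r addrC; congr (_ + _).
  rewrite big_add1 /= big_mkord (reindex_inj rev_ord_inj) /=.
  by apply: eq_bigr => j _; rewrite subKn //.
have [m sz_p] : exists m, size p = m.+1.
  by exists (size p).-1; rewrite prednK // size_poly_gt0 monic_neq0.
have pm1 : p`_m = 1 by move/monicP: mon_p; rewrite lead_coefE sz_p.
have eq0 : \sum_(j < m.+1) (val p`_j)`_(m - j) * f ^+ j = 0.
  transitivity ((map_poly (val : rees_type -> {poly R}) p).[f%:P * 'X]`_m).
    rewrite (@horner_coef_wide _ m.+1); last first.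
      by rewrite -sz_p size_poly.
    rewrite coef_sum; apply: eq_bigr => j _.
    rewrite coef_map exprMn -rmorphXn /= mulrA coefMXn ltnNge -ltnS ltn_ord /=.
    by rewrite coefMC.
  by rewrite px0 coef0.
exists m, (fun i => (val p`_(m - i))`_i); split.
- case: m sz_p pm1 eq0 => // sz_p pm1; rewrite big_ord1 pm1 /= coef1 mulr1.
  by move/eqP; rewrite oner_eq0.
- by move=> i _; apply/reesP/valP.
- rewrite -[RHS]eq0 big_ord_recr /= subnn pm1 /= coef1 mul1r addrC; congr (_ + _).
  rewrite big_add1 /= big_mkord (reindex_inj rev_ord_inj) /=.
  by apply: eq_bigr => j _; rewrite subnSK // subKn // ltnW.
Qed.

Definition closure_pred : {pred R^o} := fun f => `[< integral_over f >].

Lemma closure_pred_closed : submod_closed closure_pred.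
Proof.
split=> [|a f g /asboolP int_f /asboolP int_g].
  apply/asboolP; exists 1%N, (fun=> 0); split=> // [i _|]; first exact: ideal0.
  by rewrite big_nat1 mul0r addr0 expr1.
apply/asboolP.
have: integral_over (a * f).
  have [m [c [m_gt0 Ic eq0]]] := int_f.
  exists m, (fun i => a ^+ i * c i); split=> // [i /Ic|]; first exact: idealMl.
  rewrite -[RHS](mulr0 (a ^+ m)) -[in RHS]eq0 mulrDr mulr_sumr exprMn.
  congr (_ + _); apply: eq_big_nat => i /andP[_ le_im].
  by rewrite exprMn mulrACA -exprD subnKC.
move=> /integral_reesP int_af; apply/integral_reesP.
rewrite rmorphD mulrDl; apply: integral_add; first exact: int_af.
exact/integral_reesP.
Qed.

HB.instance Definition _ := GRing.isSubmodClosed.Build R R^o closure_pred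
  closure_pred_closed.

Definition integral_closure : ideal R := closure_pred.

End IntegralClosure.

Section SubmoduleAndQuotient.
Variables (R : comNzRingType) (V : lmodType R) (N : submodClosed V).

Record submod := Submod { submod_val :> V; _ : submod_val \in N }.
HB.instance Definition _ := [isSub for submod_val].
HB.instance Definition _ := [Choice of submod by <:].
HB.instance Definition _ := [SubChoice_isSubLmodule of submod by <:].

(* [submodClosed] does not coerce to the [zmodClosed] that the library's
   quotient of an additive group expects, hence this renaming of N. *)
Definition zmod_pred : {pred V} := fun v => v \in N.

Lemma zmod_pred_closed : zmod_closed zmod_pred.
Proof.
split=> [|u v Nu Nv]; first exact: (rpred0 N).
by rewrite -[_ \in _]/(u - v \in N) rpredD // -scaleN1r rpredZ.
Qed.

HB.instance Definition _ := GRing.isZmodClosed.Build V zmod_pred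
  zmod_pred_closed.

Definition quotmod : Type := Quotient.quot zmod_pred.
HB.instance Definition _ := ZmodQuotient.on quotmod.

Definition quotmod_pi (v : V) : quotmod := \pi v.

Lemma quotmod_piE u v : (quotmod_pi u = quotmod_pi v) <-> (u - v \in N).
Proof.
have := Quotient.idealrBE zmod_pred u v; rewrite -[_ \in _]/(u - v \in N) => ->.
by split=> /eqP.
Qed.

Lemma quotmod_piK q : quotmod_pi (repr q) = q.
Proof. exact: reprK. Qed.

Lemma quotmod_piD u v : quotmod_pi (u + v) = quotmod_pi u + quotmod_pi v.
Proof. exact: pi_addr. Qed.

Definition quotmod_scale (a : R) (q : quotmod) : quotmod :=
  quotmod_pi (a *: repr q).

Lemma quotmod_scaleE a v : quotmod_scale a (quotmod_pi v) = quotmod_pi (a *: v).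
Proof.
apply/quotmod_piE; rewrite -scalerBr rpredZ //.
by apply/quotmod_piE; rewrite quotmod_piK.
Qed.

Lemma quotmod_scaleA a b q :
  quotmod_scale a (quotmod_scale b q) = quotmod_scale (a * b) q.
Proof. by rewrite -[q]quotmod_piK !quotmod_scaleE scalerA. Qed.

Lemma quotmod_scale1 : left_id 1 quotmod_scale.
Proof. by move=> q; rewrite -[q]quotmod_piK quotmod_scaleE scale1r. Qed.

Lemma quotmod_scaleDr : right_distributive quotmod_scale +%R.
Proof.
move=> a p q; rewrite -[p]quotmod_piK -[q]quotmod_piK -quotmod_piD.
by rewrite !quotmod_scaleE -quotmod_piD scalerDr.
Qed.

Lemma quotmod_scaleDl q : {morph quotmod_scale^~ q : a b / a + b}.
Proof.
move=> a b; rewrite -[q]quotmod_piK !quotmod_scaleE -quotmod_piD.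
by rewrite scalerDl.
Qed.

HB.instance Definition _ := GRing.Zmodule_isLmodule.Build R quotmod
  quotmod_scaleA quotmod_scale1 quotmod_scaleDr quotmod_scaleDl.

End SubmoduleAndQuotient.

(* Depths: [None] stands for infinity. *)
Definition enat := option nat.

Definition enat_le (a b : enat) : bool :=
  match a, b with
  | _, None => true
  | None, Some _ => false
  | Some i, Some j => (i <= j)%N
  end.

Definition enat_min (a b : enat) : enat := if enat_le a b then a else b.

Section StanleyDepth.
Variables (K : fieldType) (n : nat).
Local Notation S := {mpoly K[n]}.

Definition polynomial_in (Z : {set 'I_n}) (f : S) : Prop :=
  forall m, m \in msupp f -> forall i, i \notin Z -> m i = 0%N.

Section Module.
(* [Mdeg a] is the component of degree a of the Z^n-graded module M. The
   K-vector space structure of M is the one given by the constants of S. *)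
Variables (M : lmodType S) (Mdeg : ('I_n -> int) -> M -> Prop).

Definition homogeneous (u : M) : Prop := exists a, Mdeg a u.

Definition stanley_space (u : M) (Z : {set 'I_n}) (w : M) : Prop :=
  exists2 v, polynomial_in Z v & w = v *: u.

(* uK[Z] is finitely generated over K[Z], so a basis of it is finite. *)
Definition free_over (Z : {set 'I_n}) (W : M -> Prop) : Prop :=
  exists (r : nat) (b : 'I_r -> M),
    (forall i, W (b i)) /\
    (forall w, W w -> exists! c : {ffun 'I_r -> S},
       (forall i, polynomial_in Z (c i)) /\ w = \sum_i c i *: b i).

Definition direct_sum (r : nat) (W : 'I_r -> M -> Prop) : Prop :=
  forall w : M, exists! t : {ffun 'I_r -> M},
    (forall i, W i (t i)) /\ w = \sum_i t i.

(* The zero module being free (of rank 0), [sd_gen i = 0] is not excluded; such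
   a summand can only lower [sdepth_of], hence does not affect [sdepth]. *)
Record stanley_decomposition := StanleyDecomposition {
  sd_size : nat;
  sd_gen : 'I_sd_size -> M;
  sd_vars : 'I_sd_size -> {set 'I_n};
  sd_homogeneous : forall i, homogeneous (sd_gen i);
  sd_free : forall i,
    free_over (sd_vars i) (stanley_space (sd_gen i) (sd_vars i));
  sd_direct : direct_sum (fun i => stanley_space (sd_gen i) (sd_vars i))
}.

Definition sdepth_of (D : stanley_decomposition) : enat :=
  \big[enat_min/None]_(i < sd_size D) Some #|sd_vars i|.

(* The maximum of [sdepth_of D] over all D, whose possible values are infinity
   (for the empty decomposition, that is for M = 0) and 0, ..., n. *)
Definition sdepth : enat :=
  if `[< exists D, sdepth_of D = None >] then None
  else Some (\max_(d < n.+1 | `[< exists D, sdepth_of D = Some (d : nat) >]) d).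

End Module.

(* The component of degree a of S: it is 0 if a has a negative entry. *)
Definition zn_deg (a : 'I_n -> int) (f : S) : Prop :=
  forall m, m \in msupp f -> forall i, (m i)%:Z = a i.

Definition sdepth_ideal (I : ideal S) : enat :=
  sdepth (fun a (u : submod I) => zn_deg a (val u)).

(* The homogeneous elements of S/I are the classes of those of S. *)
Definition sdepth_quotient (I : ideal S) : enat :=
  sdepth (fun a (q : quotmod I) => exists2 f, zn_deg a f & q = quotmod_pi I f).

Definition monomial_ideal (I : ideal S) : Prop :=
  exists G : 'X_{1..n} -> Prop, forall f : S,
    (f \in I) = (f \in gen_ideal (fun p => exists2 m, G m & p = 'X_[m])).

End StanleyDepth.

(* Main.v *)
(* For J a monomial ideal, a Stanley decomposition of J, or of S/J, with all
   dimensions at least d is the same as a partition of the exponents of the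
   monomials inside, respectively outside, J into finitely many cells m + N^Z
   with |Z| >= d.  The preimage of a cell under p |-> k p is empty or a cell with
   the same Z, so such partitions for I^(sk) pull back to partitions for the
   integral closure as soon as u is in the latter iff u^(sk) is in I^(sk).

   That a single k serves all u and s follows from Dickson's lemma, once every
   monomial u of an integral f is known to satisfy u^b \in I^b for some b > 0.
   For this, an integral equation of f gives for each monomial u of f a relation
   b u = p + \sum_l a_l l over the monomials l of f, where a_u < b and X^p is in
   I^(b - \sum_l a_l).  Eliminating all monomials but u leaves (b - a_u) u = p
   with X^p in I^(b - a_u). *)

Require Import Defs.
From mathcomp Require Import all_boot all_order all_algebra.
From mathcomp Require Import mpoly zify boolp.

Set Implicit Arguments.
Unset Strict Implicit.
Unset Printing Implicit Defensive.

Import GRing.Theory.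

(** * Cells of exponents, their preimages under scaling, and Dickson's lemma *)

Section Cells.
Variable n : nat.
Implicit Types (c : 'X_{1..n} * {set 'I_n}) (m p u : 'X_{1..n}).
Implicit Types (P Q : pred 'X_{1..n}).

(* [(m, Z)] stands for the set of exponents of the monomials in X^m K[Z]. *)
Definition in_cell c p : bool :=
  [forall i, (c.1 i <= p i) && ((i \notin c.2) ==> (c.1 i == p i))].

Lemma in_cellP c p :
  reflect ((c.1 <= p)%MM /\ forall i, i \notin c.2 -> c.1 i = p i)
          (in_cell c p).
Proof.
apply: (iffP forallP) => [H|[/mnm_lepP le_cp eq_cp] i].
  split=> [|i Zi]; first by apply/mnm_lepP => i; have /andP[] := H i.
  by have /andP[_ /implyP/(_ Zi)/eqP] := H i.
by rewrite le_cp; apply/implyP => /eq_cp ->.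
Qed.

(** An equality of numbers, so that covering P, staying inside P and being disjoint (repetitions in
    [s] included) are one condition. *)
Definition cell_partition (s : seq ('X_{1..n} * {set 'I_n})) P :=
  forall p, \sum_(c <- s) in_cell c p = P p :> nat.

Definition cell_depth_ge d P :=
  exists2 s, cell_partition s P & all (fun c => d <= #|c.2|) s.

Definition has_cell_root k c := [forall i, (i \notin c.2) ==> (k %| c.1 i)].

(** The corner is the coordinatewise ceiling of [c.1 / k], because [c.1 i <= k * p i] iff [p i] is
    at least that ceiling. Under [has_cell_root] the division is exact on the fixed coordinates. *)
Definition cell_root k c : 'X_{1..n} * {set 'I_n} :=
  ([multinom ((c.1 i + k.-1) %/ k)%N | i < n], c.2).

Lemma in_cell_mulm k c p : 0 < k ->
  in_cell c (p *+ k)%MM = has_cell_root k c && in_cell (cell_root k c) p.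
Proof.
move=> k_gt0; rewrite /in_cell /has_cell_root.
have ceil_le a b : ((a + k.-1) %/ k <= b) = (a <= b * k).
  by rewrite -ltnS ltn_divLR // mulSn; lia.
have ceilK b : (b * k + k.-1) %/ k = b.
  by rewrite divnMDl // divn_small ?addn0 // prednK.
apply/forallP/andP => [H|[/forallP dvd /forallP H] i]; last first.
  have:= H i; rewrite mnmE mulmnE ceil_le => /andP[-> /=].
  case: (i \in c.2) (dvd i) => //= /dvdnP[q ->]; rewrite ceilK.
  by move=> /eqP ->.
split; apply/forallP => i; have:= H i; rewrite ?mnmE mulmnE ?ceil_le.
  by case: (i \in c.2) => //= /andP[_ /eqP ->]; apply: dvdn_mull.
by case: (i \in c.2) => //= /andP[-> /eqP ->]; rewrite ceilK eqxx.
Qed.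

Lemma cell_depth_ge_root k d P Q : 0 < k -> (forall p, Q p = P (p *+ k)%MM) ->
  cell_depth_ge d P -> cell_depth_ge d Q.
Proof.
move=> k_gt0 defQ [s s_part s_ge].
exists [seq cell_root k c | c <- s & has_cell_root k c] => [p|].
  rewrite defQ -s_part big_map big_filter big_mkcond; apply: eq_bigr => c _.
  by rewrite in_cell_mulm //; case: (has_cell_root k c).
rewrite all_map; apply/allP => c; rewrite mem_filter => /andP[_ /(allP s_ge)].
by [].
Qed.

(* Dickson's lemma, by induction on the set of coordinates compared: the points
   not above a basis for the remaining coordinates have bounded [i]-th entry. *)
Lemma dickson (T : 'X_{1..n} -> Prop) : exists2 G : seq 'X_{1..n},
  forall g, g \in G -> T g & forall u, T u -> exists2 g, g \in G & (g <= u)%MM.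
Proof.
suff H (s : seq 'I_n) : forall U : 'X_{1..n} -> Prop,
    exists2 G : seq 'X_{1..n}, forall g, g \in G -> U g &
    forall u, U u -> exists2 g, g \in G & {in s, forall i, g i <= u i}.
  have [G GT Gle] := H (enum 'I_n) T; exists G => // u /Gle[g Gg le_gu].
  by exists g => //; apply/mnm_lepP => i; apply: le_gu; rewrite mem_enum.
elim: s => [|i s IHs] U.
  have [[u Uu]|noU] := pselect (exists u, U u).
    by exists [:: u] => [g|v Uv]; [rewrite inE => /eqP ->|exists u; rewrite ?inE].
  by exists nil => // u Uu; case: noU; exists u.
have [G0 G0U G0le] := IHs U.
pose N := \max_(g <- G0) g i.
have [G GU Gle] : exists2 G : seq 'X_{1..n}, forall g, g \in G -> U g &
    forall u, U u -> u i < N -> exists2 g, g \in G & {in i :: s, forall j, g j <= u j}.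
  (* The slices of constant [i]-th entry below the bound are added one at a time; inside a slice
     only the coordinates in [s] remain to be compared. *)
  elim: N => [|N [G GU Gle]]; first by exists nil.
  have [G1 G1U G1le] := IHs (fun u => U u /\ u i = N).
  exists (G ++ G1) => [g|u Uu].
    by rewrite mem_cat => /orP[/GU|/G1U[]].
  rewrite ltnS leq_eqVlt => /orP[/eqP uiN|/(Gle u Uu)[g Gg le_gu]]; last first.
    by exists g; rewrite ?mem_cat ?Gg.
  have [g Gg le_gu] := G1le u (conj Uu uiN).
  exists g; rewrite ?mem_cat ?Gg ?orbT // => j.
  rewrite inE => /orP[/eqP ->|/le_gu //].
  by have [_ ->] := G1U g Gg; rewrite uiN.
exists (G ++ G0) => [g|u Uu]; first by rewrite mem_cat => /orP[/GU|/G0U].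
have [uiN|Nui] := ltnP (u i) N.
  by have [g Gg le_gu] := Gle u Uu uiN; exists g; rewrite ?mem_cat ?Gg.
have [g Gg le_gu] := G0le u Uu.
exists g; rewrite ?mem_cat ?Gg ?orbT // => j.
rewrite inE => /orP[/eqP ->|/le_gu //].
by apply: leq_trans Nui; apply: leq_bigmax_seq.
Qed.

End Cells.

Local Open Scope ring_scope.

(** * Monomial ideals and their powers *)

Section MonomialPowers.
Variables (K : fieldType) (n : nat).
Implicit Types (I J : ideal {mpoly K[n]}) (m p u v w : 'X_{1..n}).

(** This form of being a monomial ideal mentions no generators and can be checked directly for
    powers and for the integral closure. *)
Definition monomially_closed J :=
  forall f, f \in J -> forall m, m \in msupp f -> 'X_[m] \in J.

Lemma ideal_mpolyX J m p : (m <= p)%MM -> 'X_[m] \in J -> 'X_[p] \in J.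
Proof. by move=> /submK <- Jm; rewrite mpolyXD; apply: idealMl. Qed.

(** Every monomial of [\sum_j c j * g j] is a multiple of a monomial of some [g j]. *)
Lemma gen_ideal_monomially_closed (A : {mpoly K[n]} -> Prop) :
  (forall g m, A g -> m \in msupp g -> 'X_[m] \in gen_ideal A) ->
  monomially_closed (gen_ideal A).
Proof.
move=> closA f /gen_predP[r [c [g [Ag ->]]]] m /msupp_sum_le.
case/flattenP=> _ /mapP[i _ ->] /msuppM_le/allpairsP[[a b] [_ gb ->]] /=.
by rewrite mpolyXD; apply/idealMl/(closA (g i)).
Qed.

Lemma monomial_ideal_closed I : monomial_ideal I -> monomially_closed I.
Proof.
case=> G defI f; rewrite defI => Gf m fm; rewrite defI.
apply: gen_ideal_monomially_closed fm => // g p [q Gq ->].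
by rewrite msuppX inE => /eqP ->; apply: gen_ideal_mem; exists q.
Qed.

Lemma msupp_prod_le r (g : 'I_r -> {mpoly K[n]}) m :
  m \in msupp (\prod_i g i) ->
  exists2 h : 'I_r -> 'X_{1..n}, forall i, h i \in msupp (g i) &
    'X_[m] = \prod_i 'X_[h i] :> {mpoly K[n]}.
Proof.
elim: r => [|r IHr] in g m *.
  rewrite big_ord0 msupp1 inE => /eqP ->; exists (fun=> 0%MM) => [[]//|].
  by rewrite big_ord0 mpolyX0.
rewrite big_ord_recl => /msuppM_le/allpairsP[[a b] [ga /IHr[h gh Xb] ->]] /=.
exists (fun i => if unlift ord0 i is Some j then h j else a) => [i|].
  by case: unliftP => [j|] ->.
rewrite big_ord_recl unlift_none mpolyXD Xb; congr (_ * _).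
by apply: eq_bigr => i _; rewrite liftK.
Qed.

Lemma ideal_pow_monomially_closed I k :
  monomially_closed I -> monomially_closed (ideal_pow I k).
Proof.
move=> monI; apply: gen_ideal_monomially_closed => _ m [g [Ig ->]].
case/msupp_prod_le=> h gh Xm; apply: gen_ideal_mem.
by exists (fun i => 'X_[h i]); split=> // i; apply: monI (gh i).
Qed.

Lemma ideal_pow_mulm I i c p :
  'X_[p] \in ideal_pow I i -> 'X_[p *+ c] \in ideal_pow I (i * c).
Proof.
move=> Ip; elim: c => [|c IHc]; first by rewrite muln0 ideal_pow0.
by rewrite mulmS mulnS mpolyXD ideal_powM.
Qed.

End MonomialPowers.

(** * Monomials of integral elements and a uniform exponent *)

Section IntegralMonomials.
Variables (K : fieldType) (n : nat) (I : ideal {mpoly K[n]}).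
Implicit Types (f g : {mpoly K[n]}) (T : seq 'X_{1..n}) (u v w p : 'X_{1..n}).

(** For a duplicate-free T this is membership in its k-fold sumset. Multiplicities are recorded
    instead of a list of summands, since relations get scaled and added. *)
Definition combination T k w :=
  exists2 a : 'X_{1..n} -> nat, (\sum_(l <- T) a l)%N = k &
    forall j, w j = (\sum_(l <- T) l j * a l)%N.

Lemma combination0 T : combination T 0 0%MM.
Proof.
exists (fun=> 0%N) => [|j]; first by rewrite big1.
by rewrite mnm0E big1 // => l _; rewrite muln0.
Qed.

Lemma combinationD T k1 k2 w1 w2 :
  combination T k1 w1 -> combination T k2 w2 ->
  combination T (k1 + k2) (w1 + w2)%MM.
Proof.
move=> [a1 <- wE1] [a2 <- wE2]; exists (fun l => (a1 l + a2 l)%N) => [|j].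
  by rewrite big_split.
by rewrite mnmDE wE1 wE2 -big_split; apply: eq_bigr => l _; rewrite mulnDr.
Qed.

Lemma combination1 T u : uniq T -> u \in T -> combination T 1 u.
Proof.
move=> uT Tu; exists (fun l => l == u : nat) => [|j].
  rewrite (bigD1_seq u) //= eqxx big1 ?addn0 // => l /negPf -> //.
rewrite (bigD1_seq u) //= eqxx muln1 big1 ?addn0 // => l /negPf ->.
by rewrite muln0.
Qed.

Lemma combinationM T k u : combination T 1 u -> combination T k (u *+ k)%MM.
Proof.
move=> Tu; elim: k => [|k IHk]; first exact: combination0.
by rewrite mulmS; apply: (combinationD Tu IHk).
Qed.

Lemma msupp_exp_combination T f k w : uniq T -> {subset msupp f <= T} ->
  w \in msupp (f ^+ k) -> combination T k w.
Proof.
move=> uT fT; elim: k => [|k IHk] in w *.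
  by rewrite expr0 msupp1 inE => /eqP ->; apply: combination0.
rewrite exprS => /msuppM_le/allpairsP[[a b] [/fT Ta /IHk Tb ->]] /=.
exact: (combinationD (combination1 uT Ta) Tb).
Qed.

(** The index [i] stands for [b - \sum_l a_l], written additively to avoid truncated subtraction.
    The condition [a u < b] excludes the trivial relation [b u = b u]. *)
Definition integral_relation T u := exists b i p (a : 'X_{1..n} -> nat),
  [/\ 'X_[p] \in ideal_pow I i, (a u < b)%N,
      b = (i + \sum_(l <- T) a l)%N
    & forall j, (u j * b)%N = (p j + \sum_(l <- T) l j * a l)%N].

Lemma integral_relation_perm T1 T2 u :
  perm_eq T1 T2 -> integral_relation T1 u -> integral_relation T2 u.
Proof.
move=> eqT [b [i [p [a [Ip au bE uE]]]]]; exists b, i, p, a; split=> //.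
  by rewrite -(perm_big _ eqT).
by move=> j; rewrite -(perm_big _ eqT).
Qed.

(* Substituting the relation for x into that for u; the strict inequality can
   only fail if u <= x <= u. *)
Lemma integral_relation_elim T x u : uniq (x :: T) -> u \in T ->
  integral_relation (x :: T) x -> integral_relation (x :: T) u ->
  integral_relation T u.
Proof.
move=> /= /andP[xT uT] Tu [b1 [i1 [p1 [a1 [Ip1 a1x b1E xE]]]]].
move=> [b [i [p [a [Ip au bE uE]]]]].
have neq_xu : x <> u by move=> eq_xu; rewrite eq_xu Tu in xT.
move: b1E xE bE uE; rewrite !big_cons => b1E xE bE uE.
have {}xE j : (x j * (b1 - a1 x) = p1 j + \sum_(l <- T) l j * a1 l)%N.
  by have := xE j; rewrite big_cons mulnBr => ->; lia.
have {}uE j : (u j * b = p j + (x j * a x + \sum_(l <- T) l j * a l))%N.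
  by have := uE j; rewrite big_cons.
pose c := (b1 - a1 x)%N.
have cE : c = (i1 + \sum_(l <- T) a1 l)%N by rewrite /c; lia.
have c_gt0 : (0 < c)%N by rewrite /c; lia.
have sumE (F : 'X_{1..n} -> nat) :
    (\sum_(l <- T) F l * (c * a l + a x * a1 l) =
     c * (\sum_(l <- T) F l * a l) + a x * (\sum_(l <- T) F l * a1 l))%N.
  by rewrite !big_distrr -big_split; apply: eq_bigr => l _ /=; lia.
(* This is c times the relation for u, in which [c x] is replaced by the right side of the relation
   for x. *)
exists (c * b)%N, (i * c + i1 * a x)%N, (p *+ c + p1 *+ a x)%MM,
  (fun l => (c * a l + a x * a1 l)%N); split.
- by rewrite mpolyXD; apply: ideal_powM; apply: ideal_pow_mulm.
- move: cE bE; rewrite (bigD1_seq u) // (bigD1_seq u (F := a)) //=.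
  set A1 := \sum_(l <- T | _) a1 l; set A := \sum_(l <- T | _) a l => cE bE.
  have le_a1c : (a1 u <= c)%N by lia.
  have le_c : (c * a u + a x * a1 u <= c * b)%N.
    by rewrite bE; nia.
  (* Equality leaves no slack in [a1 u <= c] and [a x + a u <= b]. The relation for u then gives
     [x <= u] and the one for x gives [u <= x]. *)
  rewrite ltn_neqAle le_c andbT; apply/eqP => eq_c; apply: neq_xu.
  have ax_gt0 : (0 < a x)%N by nia.
  have a1uE : a1 u = c by nia.
  have bE' : b = (a x + a u)%N by nia.
  apply/mnmP => j; apply/eqP; rewrite eqn_leq; apply/andP; split.
    have := uE j; rewrite (bigD1_seq u) //= bE'; nia.
  have := xE j; rewrite -/c (bigD1_seq u) //= a1uE; nia.
- have := sumE (fun=> 1%N); under eq_bigr do rewrite mul1n.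
  move=> ->; under eq_bigr do rewrite mul1n.
  under [in (a x * _)%N]eq_bigr do rewrite mul1n.
  by rewrite bE; nia.
- move=> j; rewrite (sumE (fun l => l j)) mnmDE !mulmnE.
  have := uE j; have := xE j; rewrite -/c; nia.
Qed.

Lemma integral_relation1 u : integral_relation [:: u] u ->
  exists2 b, (0 < b)%N & 'X_[u *+ b] \in ideal_pow I b.
Proof.
move=> [b [i [p [a [Ip au]]]]]; rewrite !big_seq1 => bE.
move=> uE; exists i; first by lia.
suff -> : (u *+ i)%MM = p by [].
apply/mnmP => j; rewrite mulmnE; have := uE j.
by rewrite big_seq1 bE; nia.
Qed.

(** Relations are required for all of T because eliminating x uses the relation for x itself, and
    the shorter list must satisfy the same hypothesis. *)
Lemma integral_relation_mulm T u : uniq T -> u \in T ->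
  (forall x, x \in T -> integral_relation T x) ->
  exists2 b, (0 < b)%N & 'X_[u *+ b] \in ideal_pow I b.
Proof.
move sT: (size T) => r.
elim: r => [|r IHr] in T sT *; first by move/size0nil: sT => ->.
move=> uT Tu relT.
have [sub_u|/allPn[x Tx /eqP/eqP neq_xu]] := boolP (all (pred1 u) T).
  apply: integral_relation1; apply: integral_relation_perm (relT u Tu).
  apply: uniq_perm => // l; rewrite inE; apply/idP/eqP => [/(allP sub_u)/eqP|] //.
  by move->.
have eqT := perm_to_rem Tx.
have relT' y : y \in x :: rem x T -> integral_relation (x :: rem x T) y.
  by rewrite -(perm_mem eqT) => /relT; apply: integral_relation_perm.
have uT' : uniq (x :: rem x T) by rewrite -(perm_uniq eqT).
apply: (IHr (rem x T)).
- by rewrite size_rem // sT.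
- by case/andP: uT'.
- by have := Tu; rewrite (perm_mem eqT) inE eq_sym (negPf neq_xu).
move=> y Ty; apply: (integral_relation_elim uT') => //.
  by apply: relT'; rewrite mem_head.
by apply: relT'; rewrite inE Ty orbT.
Qed.

Hypothesis monI : monomially_closed I.

(* Either u^m is a monomial of some c_i f^(m - i), or u^m has coefficient 0 in
   f^m, and is then also a product of m monomials of f that are not all u. *)
Lemma integral_over_relation f u :
  integral_over I f -> u \in msupp f -> integral_relation (msupp f) u.
Proof.
move=> [m [c [m_gt0 Ic eq0]]] fu; set T := msupp f.
have uT : uniq T by apply: msupp_uniq.
have sum_ge v (a : 'X_{1..n} -> nat) : v \in T -> (a v <= \sum_(l <- T) a l)%N.
  by move=> Tv; rewrite (bigD1_seq v) //= leq_addr.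
have [[i /andP[i_gt0 le_im] /msuppM_le/allpairsP[[p w] [cp fw wE]]]|no_i] :=
    pselect (exists2 i, (1 <= i <= m)%N &
               (u *+ m)%MM \in msupp (c i * f ^+ (m - i))).
  move: cp fw wE => /= cp fw wE.
  have [a aE waE] := msupp_exp_combination uT (fun=> id) fw.
  exists m, i, p, a; split.
  - by apply: (ideal_pow_monomially_closed monI) cp; apply: Ic; rewrite i_gt0.
  - by have := sum_ge u a fu; lia.
  - by lia.
  - by move=> j; rewrite -mulmnE wE mnmDE waE.
have fm0 : (f ^+ m)@_(u *+ m) = 0.
  have := congr1 (mcoeff (u *+ m)%MM) eq0.
  rewrite mcoeffD mcoeff0 raddf_sum /= big_nat_cond big1 ?addr0 // => i.
  rewrite andbT => le_im; apply: memN_msupp_eq0; apply/negP => w_i.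
  by apply: no_i; exists i.
(* [q] is the term of f at u. Since [q ^+ m] has a nonzero coefficient at [u *+ m] and [f ^+ m] has
   none, the exponent occurs in [f ^+ m - q ^+ m], a multiple of [f - q]; this yields a factor [v]
   other than u. *)
pose q := f@_u *: 'X_[u] : {mpoly K[n]}.
have qu : {subset msupp q <= T}.
  by move=> v /msuppZ_le; rewrite msuppX inE => /eqP ->.
have : (u *+ m)%MM \in msupp (f ^+ m - q ^+ m).
  rewrite mcoeff_msupp mcoeffB fm0 sub0r oppr_eq0 exprZn mcoeffZ mcoeffXn eqxx.
  by rewrite mulr1 expf_neq0 // -mcoeff_msupp.
rewrite subrXX => /msuppM_le/allpairsP[[v w] [/= fv /msupp_sum_le]].
case/flattenP=> _ /mapP[i _ ->] /msuppM_le/allpairsP[[w1 w2] [/= fw1 qw2 ->]] wE.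
move: fv; rewrite /q (perm_mem (msupp_rem _ _)) (mem_rem_uniq _ uT) !inE.
move=> /andP[neq_vu Tv].
have [a aE waE] : combination T m.-1 (w1 + w2)%MM.
  have -> : m.-1 = ((m.-1 - i) + i)%N by have := ltn_ord i; lia.
  apply: combinationD; last exact: msupp_exp_combination qw2.
  by apply: msupp_exp_combination (fun=> id) _ => //; move: fw1; rewrite subn1.
(* No coefficient of the equation enters here: [u *+ m] is [v] plus [m - 1] exponents from T, so u
   is counted at most [m - 1] times. *)
exists m, 0%N, 0%MM, (fun l => (a l + (l == v))%N).
have [d dE vE] := combination1 uT Tv.
split.
- exact: ideal_pow0.
- by have := sum_ge u a fu; rewrite eq_sym (negPf neq_vu); lia.
- rewrite big_split /= aE (bigD1_seq v) //= eqxx big1 => [|l /negPf ->] //; lia.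
- move=> j; rewrite -mulmnE wE mnmDE waE mnm0E add0n addnC.
  under [RHS]eq_bigr do rewrite mulnDr.
  rewrite big_split /=; congr addn; rewrite (bigD1_seq v) //= eqxx muln1 big1 ?addn0 //.
  by move=> l /negPf ->; rewrite muln0.
Qed.

Lemma msupp_integral f u : integral_over I f -> u \in msupp f ->
  exists2 b, (0 < b)%N & 'X_[u *+ b] \in ideal_pow I b.
Proof.
move=> int_f fu; apply: (integral_relation_mulm (msupp_uniq f) fu) => x.
exact: integral_over_relation.
Qed.

(** [X^u] is a root of [T^b - X^(b u)], whose constant term lies in [I^b]. *)
Lemma integral_mpolyX u b : (0 < b)%N ->
  'X_[u *+ b] \in ideal_pow I b -> integral_over I 'X_[u].
Proof.
move=> b_gt0 Iu; exists b, (fun i => if i == b then - 'X_[u *+ b] else 0).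
split=> // [i _|].
  by case: eqP => [->|_]; rewrite ?ideal0 // -mulN1r idealMl.
rewrite big_nat_recr //= eqxx subnn expr0 mulr1 mpolyXn big_nat_cond big1.
  by rewrite add0r subrr.
by move=> i /andP[/andP[_ lt_ib] _]; rewrite ltn_eqF // mul0r.
Qed.

Lemma mem_integral_closure f :
  (f \in integral_closure I) <-> integral_over I f.
Proof. by split=> /asboolP. Qed.

Lemma integral_closure_monomially_closed :
  monomially_closed (integral_closure I).
Proof.
move=> f /mem_integral_closure int_f m /(msupp_integral int_f)[b b_gt0 Ib].
exact/mem_integral_closure/(integral_mpolyX b_gt0).
Qed.

(** Finitely many monomials g generate those of the closure, and [X^(k u)] is a multiple of
    [X^(k g)] when u lies above g. For [s = 0] the right side would hold for every u. *)
Lemma integral_closure_exponent : exists2 k, (0 < k)%N &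
  forall s u, (0 < s)%N -> ('X_[u] \in integral_closure I) =
    ('X_[u *+ (s * k)] \in ideal_pow I (s * k)).
Proof.
have [G GI Gle] := dickson (fun u => 'X_[u] \in integral_closure I).
have [k k_gt0 Gk] : exists2 k, (0 < k)%N &
    forall g : 'X_{1..n}, g \in G -> 'X_[g *+ k] \in ideal_pow I k.
  elim: G GI {Gle} => [|g G IHG] GI; first by exists 1%N.
  have [|k k_gt0 Gk] := IHG; first by move=> h Gh; apply: GI; rewrite inE Gh orbT.
  have /mem_integral_closure int_g := GI g (mem_head _ _).
  have [|b b_gt0 Ib] := msupp_integral int_g (u := g).
    by rewrite msuppX mem_head.
  (* k is built up as the product of the exponents b belonging to the members of [G]. *)
  exists (b * k)%N; first by rewrite muln_gt0 b_gt0.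
  have mulmA h x y : (h *+ (x * y) = (h *+ x) *+ y :> 'X_{1..n})%MM.
    by apply/mnmP => j; rewrite !mulmnE mulnA.
  move=> h; rewrite inE => /orP[/eqP ->|/Gk Ih].
    by rewrite mulmA ideal_pow_mulm.
  by rewrite mulnC mulmA ideal_pow_mulm.
exists k => // s u s_gt0; apply/idP/idP => [/Gle[g /Gk Ig le_gu]|].
  apply: (@ideal_mpolyX _ _ _ (g *+ (s * k))%MM).
    by apply/mnm_lepP => j; rewrite !mulmnE leq_mul2r (mnm_lepP le_gu) orbT.
  have := ideal_pow_mulm s Ig; rewrite mulnC.
  suff -> : (g *+ (s * k) = (g *+ k) *+ s :> 'X_{1..n})%MM by [].
  by apply/mnmP => j; rewrite !mulmnE; lia.
have sk_gt0 : (0 < s * k)%N by rewrite muln_gt0 s_gt0.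
by move=> /(integral_mpolyX sk_gt0) ?; apply/mem_integral_closure.
Qed.

End IntegralMonomials.

(** * Stanley depth through its finite lower bounds *)

Lemma enat_leP (a b : enat) :
  (forall d, enat_le (Some d) a -> enat_le (Some d) b) -> enat_le a b.
Proof.
case: a b => [a|] [b|] // H; first exact: H (leqnn a).
by have := H b.+1 isT; rewrite /= ltnn.
Qed.

Section SdepthBound.
Variables (K : fieldType) (n : nat) (M : lmodType {mpoly K[n]}).
Variable Mdeg : ('I_n -> int) -> M -> Prop.
Implicit Types D : stanley_decomposition Mdeg.

Lemma sdepth_of_geP d D :
  reflect (forall i, d <= #|sd_vars (s := D) i|)%N
          (enat_le (Some d) (sdepth_of D)).
Proof.
rewrite /sdepth_of; apply: (iffP idP) => [le_d i|ge_d]; last first.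
  by elim/big_ind: _ => // [a b|i _]; [rewrite /enat_min; case: ifP|apply: ge_d].
have := mem_index_enum i; elim: (index_enum _) le_d => //= j r IHr.
rewrite big_cons inE; set x := \big[_/_]_(_ <- r) _ in IHr *.
rewrite /enat_min; case: ifP => /= [le_jx le_dj|nle_jx le_dx].
  have le_dx : enat_le (Some d) x by case: x le_jx {IHr} => //= e; apply: leq_trans.
  by move=> /orP[/eqP ->|/IHr]; [|apply].
move=> /orP[/eqP ->|/IHr]; last by apply.
by case: x nle_jx le_dx {IHr} => //= e; rewrite leqNgt => /negbFE; lia.
Qed.

(** The case [d = 0] stands apart because the maximum defining [sdepth] is 0 when there is no
    decomposition at all. *)
Lemma sdepth_geP d : enat_le (Some d) (sdepth Mdeg) <->
  d = 0%N \/ exists D, forall i, (d <= #|sd_vars (s := D) i|)%N.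
Proof.
rewrite /sdepth; case: asboolP => [[D D0]|noD] /=.
  by split=> // _; right; exists D; apply/sdepth_of_geP; rewrite D0.
split=> [le_d|[-> //|[D /sdepth_of_geP]]].
  have [|d_gt0] := posnP d; [by left | right].
  apply: contrapT => noE; move: le_d; rewrite leqNgt => /negP; apply.
  rewrite -(prednK d_gt0) ltnS; apply/bigmax_leqP => e /asboolP[D De].
  rewrite -ltnS (prednK d_gt0) ltnNge; apply/negP => le_de.
  by apply: noE; exists D; apply/sdepth_of_geP; rewrite De.
case De: (sdepth_of D) => [e|] /= le_de; last by case: noD; exists D.
(* The maximum in [sdepth] only ranges over [e <= n]. An empty decomposition has infinite depth, so
   here some [sd_vars] exists and its size bounds [e]. *)
have le_en : (e < n.+1)%N.
  rewrite ltnS leqNgt; apply/negP => lt_ne.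
  have /sdepth_of_geP H : enat_le (Some e) (sdepth_of D) by rewrite De /=.
  have [[i _]|no_i] := pselect (exists i : 'I_(sd_size D), true).
    by have := leq_trans (H i) (max_card _); rewrite card_ord; lia.
  have /sdepth_of_geP : forall i, (e.+1 <= #|sd_vars (s := D) i|)%N.
    by move=> i; case: no_i; exists i.
  by rewrite De /= ltnn.
apply: leq_trans le_de _.
apply: (leq_trans _ (leq_bigmax_cond (Ordinal le_en) _)) => //.
by apply/asboolP; exists D.
Qed.

End SdepthBound.

(** * Stanley decompositions versus partitions into cells *)

Section MonomialModule.
Variables (K : fieldType) (n : nat).
Local Notation S := {mpoly K[n]}.
Implicit Types (P Q : pred 'X_{1..n}) (m p : 'X_{1..n}).

(* A common model of ideals and quotients of S: [rep] identifies M with the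
   polynomials supported in P, on which S acts by multiplication followed by
   removal of the terms outside P. *)
Record monomial_module (M : lmodType S) (Mdeg : ('I_n -> int) -> M -> Prop)
    P (rep : M -> S) : Prop := MonomialModule {
  rep_additive : {morph rep : u v / u + v};
  rep_inj : injective rep;
  rep_onto : forall f, {subset msupp f <= P} -> exists u, rep u = f;
  rep_supp : forall u, {subset msupp (rep u) <= P};
  rep_scale : forall a u m, m \in P -> (rep (a *: u))@_m = (a * rep u)@_m;
  rep_deg : forall a u, Mdeg a u <-> zn_deg a (rep u)
}.

Variables (M : lmodType S) (Mdeg : ('I_n -> int) -> M -> Prop).
Variables (P : pred 'X_{1..n}) (rep : M -> S).
Hypothesis repM : monomial_module Mdeg P rep.

Lemma rep0 : rep 0 = 0.
Proof. by apply: (addrI (rep 0)); rewrite -(rep_additive repM) !addr0. Qed.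

Lemma rep_sum (I : Type) (r : seq I) (F : I -> M) :
  rep (\sum_(i <- r) F i) = \sum_(i <- r) rep (F i).
Proof. exact: (big_morph rep (rep_additive repM) rep0). Qed.

Lemma rep_eq0 u : (rep u == 0) = (u == 0).
Proof. by rewrite -rep0 (inj_eq (rep_inj repM)). Qed.

Lemma rep_notin u m : m \notin P -> (rep u)@_m = 0.
Proof. by move=> Pm; apply: memN_msupp_eq0; apply: contra Pm; apply: (rep_supp repM). Qed.

Lemma rep_eqP u v : (forall m, m \in P -> (rep u)@_m = (rep v)@_m) -> u = v.
Proof.
move=> eq_uv; apply: (rep_inj repM); apply/mpolyP => m.
by have [/eq_uv //|Pm] := boolP (m \in P); rewrite !rep_notin.
Qed.

(** A degree in Z^n determines the exponent, so a homogeneous element has a single term. *)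
Lemma homogeneous_rep u : homogeneous Mdeg u -> u != 0 ->
  exists2 c, c != 0 & rep u = c *: 'X_[mlead (rep u)].
Proof.
move=> [a /(rep_deg repM) deg_u]; rewrite -rep_eq0 => u_neq0.
have lead_u := mlead_supp u_neq0.
exists (mleadc (rep u)); first by rewrite mleadc_eq0.
rewrite {1}[rep u]mpolyE (bigD1_seq (mlead (rep u))) ?msupp_uniq //= big1_seq ?addr0 //.
move=> m /andP[/eqP neq_m um]; case: neq_m; apply/mnmP => i.
by case: (etrans (deg_u m um i) (esym (deg_u _ lead_u i))).
Qed.

Section ToCells.
Variables (u : M) (Z : {set 'I_n}).
Hypotheses (hom_u : homogeneous Mdeg u) (u_neq0 : u != 0).
Local Notation c := (mlead (rep u), Z).

Lemma in_cell_subr p : in_cell c p -> (p - mlead (rep u) + mlead (rep u) = p)%MM.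
Proof. by move=> /in_cellP[/= le_p _]; apply: submK. Qed.

Lemma polynomial_in_cell p x : in_cell c p ->
  polynomial_in Z (x *: 'X_[p - mlead (rep u)] : S).
Proof.
move=> /in_cellP[/= le_p eq_p] m /msuppZ_le; rewrite msuppX inE => /eqP -> i Zi.
by rewrite mnmBE eq_p // subnn.
Qed.

(** If p were outside P, then [X^(p - mlead (rep u))] would kill u and with it every basis element,
    each being a multiple of u; so 0 would have two expansions in the basis. *)
Lemma free_cell_sub p : free_over Z (stanley_space u Z) -> in_cell c p -> p \in P.
Proof.
move=> [r [b [Wb b_uniq]]] cp; apply: contraNT u_neq0 => Pp.
have Xu0 : 'X_[p - mlead (rep u)] *: u = 0.
  apply: rep_eqP => m Pm; rewrite (rep_scale repM) // rep0 mcoeff0.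
  have [x _ uE] := homogeneous_rep hom_u u_neq0; rewrite [X in _ * X]uE.
  rewrite -scalerAr mcoeffZ -mpolyXD in_cell_subr //.
  by rewrite mcoeffX; case: eqP Pm Pp => [->|_]; [move=> ->|rewrite mulr0].
(* Expanding the nonzero u ensures that the basis is not empty. *)
have [d [[_ dE] _]] : exists! d : {ffun 'I_r -> S},
    (forall i, polynomial_in Z (d i)) /\ u = \sum_i d i *: b i.
  apply: b_uniq; exists 1; last by rewrite scale1r.
  by move=> m; rewrite msupp1 inE => /eqP -> i _; rewrite mnm0E.
have [d0 [_ d0_uniq]] : exists! d : {ffun 'I_r -> S},
    (forall i, polynomial_in Z (d i)) /\ 0 = \sum_i d i *: b i.
  apply: b_uniq; exists 0; last by rewrite scale0r.
  by move=> m; rewrite msupp0.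
rewrite dE; apply/eqP/big1 => i _.
have d0E : d0 = [ffun=> 0].
  apply: d0_uniq; split=> [j m|]; first by rewrite ffunE msupp0.
  by rewrite big1 // => j _; rewrite ffunE scale0r.
have d0X : d0 = [ffun=> 'X_[p - mlead (rep u)]].
  apply: d0_uniq; split=> [j m|].
    rewrite ffunE => Xm; have := polynomial_in_cell (x := 1) cp; rewrite scale1r.
    exact.
  rewrite big1 // => j _; rewrite ffunE; have [v _ ->] := Wb j.
  by rewrite scalerA mulrC -scalerA Xu0 scaler0.
have /ffunP/(_ i) := etrans (esym d0E) d0X; rewrite !ffunE => X0.
have := mcoeffX K (p - mlead (rep u)) (p - mlead (rep u)).
by rewrite -X0 mcoeff0 eqxx => /esym/eqP; rewrite oner_eq0.
Qed.

Lemma mcoeff_stanley_space w p :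
  stanley_space u Z w -> ~~ in_cell c p -> (rep w)@_p = 0.
Proof.
move=> [v Zv ->] cp; have [Pp|] := boolP (p \in P); last exact: rep_notin.
rewrite (rep_scale repM) //; apply: memN_msupp_eq0; apply: contra cp.
have [x _ uE] := homogeneous_rep hom_u u_neq0; rewrite [X in _ * X]uE.
case/msuppM_le/allpairsP=> [[a b] [/= va /msuppZ_le]].
rewrite msuppX inE => /eqP -> ->; apply/in_cellP; split=> [|i Zi] /=.
  exact: lem_addl.
by rewrite mnmDE (Zv a).
Qed.

Hypothesis cell_sub : forall p, in_cell c p -> p \in P.

(** The single element u is a basis: with the whole cell inside P, multiplying u by K[Z] loses no
    term. *)
Lemma free_stanley_space : free_over Z (stanley_space u Z).
Proof.
have [x x_neq0 uE] := homogeneous_rep hom_u u_neq0.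
exists 1%N, (fun=> u); split=> [_|_ [v Zv ->]].
  exists 1; last by rewrite scale1r.
  by move=> m; rewrite msupp1 inE => /eqP -> i _; rewrite mnm0E.
exists [ffun=> v]; split=> [|v' [Zv']].
  by split=> [i|]; rewrite ?big_ord1 ffunE.
rewrite big_ord1 => eq_v; apply/ffunP => i; rewrite ffunE (ord1 i).
apply/mpolyP => m; have [Zm|] := boolP [forall j, (j \notin Z) ==> (m j == 0%N)].
  have Pm : (mlead (rep u) + m)%MM \in P.
    apply: cell_sub; apply/in_cellP; split=> [|j Zj] /=; first exact: lem_addr.
    by have /forallP/(_ j)/implyP/(_ Zj)/eqP mj := Zm; rewrite mnmDE mj addn0.
  have := congr1 (fun y => (rep y)@_(mlead (rep u) + m)) eq_v.
  have scaleE y : (rep (y *: u))@_(mlead (rep u) + m) = x * y@_m.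
    by rewrite (rep_scale repM) // [X in _ * X]uE -scalerAr mcoeffZ mcoeffMX.
  by rewrite !scaleE => /(mulfI x_neq0).
move=> /forallPn[j]; rewrite negb_imply => /andP[Zj mj].
have notin f : polynomial_in Z f -> f@_m = 0.
  by move=> Zf; apply: memN_msupp_eq0; apply: contra mj => /Zf ->.
by rewrite !notin.
Qed.

(** Cutting w down to the cell gives what will be its component in this summand. *)
Lemma stanley_space_restriction w : exists2 t, stanley_space u Z t &
  forall p, (rep t)@_p = if in_cell c p then (rep w)@_p else 0.
Proof.
have [x x_neq0 uE] := homogeneous_rep hom_u u_neq0.
pose v := \sum_(p <- msupp (rep w) | in_cell c p)
  (x^-1 * (rep w)@_p) *: 'X_[p - mlead (rep u)] : S.
have Wv : stanley_space u Z (v *: u).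
  exists v => // m /msupp_sum_le/flattenP[_ /mapP[p + ->]].
  by rewrite mem_filter => /andP[cp _]; apply: polynomial_in_cell.
exists (v *: u) => // p; case: ifPn => cp; last exact: mcoeff_stanley_space cp.
rewrite (rep_scale repM) ?cell_sub // [X in _ * X]uE -scalerAr mcoeffZ.
rewrite mulr_suml raddf_sum /= mulr_sumr.
transitivity (\sum_(q <- msupp (rep w) | in_cell c q) (rep w)@_q * (q == p)%:R).
  apply: eq_bigr => q cq; rewrite -scalerAl mcoeffZ -mpolyXD in_cell_subr //.
  by rewrite mcoeffX !mulrA mulfV // mul1r.
have [wp|wp] := boolP (p \in msupp (rep w)).
  rewrite -big_filter (bigD1_seq p) ?filter_uniq ?msupp_uniq ?mem_filter ?cp //=.
  rewrite eqxx mulr1 big1 ?addr0 // => q /negPf ->.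
  by rewrite mulr0.
rewrite (memN_msupp_eq0 wp) big1_seq // => q /andP[_ wq].
by case: eqP wq wp => [->|_]; [move=> ->|rewrite mulr0].
Qed.

End ToCells.

Lemma stanley_decomposition_cells d :
  (exists D : stanley_decomposition Mdeg, forall i, (d <= #|sd_vars (s := D) i|)%N) ->
  cell_depth_ge d P.
Proof.
move=> [[r u Z hom_u free_u direct_u] /= ge_d].
(* Summands with zero generator contribute nothing to M and are left out of the partition below. *)
pose c i := (mlead (rep (u i)), Z i).
exists [seq c i | i <- index_enum 'I_r & u i != 0]; last first.
  by apply/allP => _ /mapP[i _ ->]; apply: ge_d.
move=> p; rewrite big_map big_filter.
have [Pp|Pp] := boolP (p \in P); last first.
  rewrite big1 => [|i ui]; first by rewrite -topredE /= in Pp; rewrite (negPf Pp).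
  by apply/eqP; rewrite eqb0; apply: contra Pp; apply: free_cell_sub.
rewrite [P p]Pp.
have [w wE] : exists w, rep w = 'X_[p].
  by apply: (rep_onto repM) => m; rewrite msuppX inE => /eqP ->.
have W0 i : stanley_space (u i) (Z i) 0.
  by exists 0; [move=> m; rewrite msupp0|rewrite scale0r].
have [t [[Wt tE] t_uniq]] := direct_u w.
(* Covering: if no cell contained p, every component of w would have coefficient 0 at p. *)
have [i0 ui0 ci0] : exists2 i, u i != 0 & in_cell (c i) p.
  apply: contrapT => no_i; have := mcoeffX K p p; rewrite -wE tE rep_sum.
  rewrite eqxx raddf_sum big1 /= => [/esym/eqP|i _]; first by rewrite oner_eq0.
  have [ui|ui] := eqVneq (u i) 0.
    by have [v _ ->] := Wt i; rewrite ui scaler0 rep0 mcoeff0.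
  apply: (mcoeff_stanley_space (hom_u i) ui (Wt i)).
  by apply/negP => ci; apply: no_i; exists i.
have Wi i : u i != 0 -> in_cell (c i) p -> stanley_space (u i) (Z i) w.
  move=> ui ci; have [x x_neq0 uE] := homogeneous_rep (hom_u i) ui.
  exists (x^-1 *: 'X_[p - mlead (rep (u i))]); first exact: polynomial_in_cell.
  apply: rep_eqP => m Pm; rewrite (rep_scale repM) // [X in _ * X]uE wE.
  by rewrite -scalerAl -scalerAr scalerA mulVf // scale1r -mpolyXD (in_cell_subr ci).
(* Disjointness: if cell i contains p, then w lies in summand i alone, so uniqueness of the
   components rules out a second such index. *)
have tE' i : u i != 0 -> in_cell (c i) p -> t = [ffun k => if k == i then w else 0].
  move=> ui ci; apply: t_uniq; split=> [k|].
    by rewrite ffunE; case: eqP => [->|_]; [apply: Wi|apply: W0].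
  rewrite (bigD1 i) //= ffunE eqxx big1 ?addr0 // => k /negPf k_i.
  by rewrite ffunE k_i.
rewrite (bigD1 i0) //= ci0 big1 ?addn0 // => i /andP[ui neq_i].
apply/eqP; rewrite eqb0; apply/negP => ci.
have := etrans (esym (tE' i ui ci)) (tE' i0 ui0 ci0).
move=> /ffunP/(_ i); rewrite !ffunE eqxx (negPf neq_i) => w0.
by have := mcoeffX K p p; rewrite -wE w0 rep0 mcoeff0 eqxx => /esym/eqP; rewrite oner_eq0.
Qed.

(** Each cell yields the Stanley space generated by the monomial at its corner. Components exist by
    restriction to the cells, and are unique because only one summand can contribute at a given
    exponent. *)
Lemma cells_stanley_decomposition d : cell_depth_ge d P ->
  exists D : stanley_decomposition Mdeg, forall i, (d <= #|sd_vars (s := D) i|)%N.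
Proof.
move=> [s part_s /allP s_ge]; pose c i := tnth (in_tuple s) i.
have sumE p : (\sum_i in_cell (c i) p = P p :> nat)%N.
  by rewrite -part_s [RHS]big_tnth.
have cell_sub i p : in_cell (c i) p -> p \in P.
  move=> ci; have := sumE p; rewrite (bigD1 i) //= ci add1n -topredE /=.
  by case: (P p).
have cell_uniq i j p : in_cell (c i) p -> in_cell (c j) p -> i = j.
  move=> ci cj; apply/eqP; apply: contraT => neq_ij; have := sumE p.
  rewrite (bigD1 i) //= ci (bigD1 j) 1?eq_sym //= cj !add1n.
  by case: (P p).
have c1 i : in_cell (c i) (c i).1 by apply/in_cellP; split; rewrite ?lepm_refl.
have onto i : exists x, rep x = 'X_[(c i).1].
  apply: (rep_onto repM) => m.
  by rewrite msuppX inE => /eqP ->; apply: cell_sub (c1 i).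
have [u uE] := choice onto.
have cE i : (mlead (rep (u i)), (c i).2) = c i.
  by rewrite uE mleadXm; case: (c i).
have hom_u i : homogeneous Mdeg (u i).
  exists (fun j => Posz ((c i).1 j)); apply/(rep_deg repM); rewrite uE => m.
  by rewrite msuppX inE => /eqP ->.
have u_neq0 i : u i != 0.
  by rewrite -rep_eq0 uE -msupp_eq0 msuppX.
have sub i p : in_cell (mlead (rep (u i)), (c i).2) p -> p \in P.
  by rewrite cE; apply: cell_sub.
have direct_u : direct_sum (fun i => stanley_space (u i) (c i).2).
  move=> w; have restr i : exists t, stanley_space (u i) (c i).2 t /\
      forall p, (rep t)@_p = if in_cell (c i) p then (rep w)@_p else 0.
    have [t Wt] := stanley_space_restriction (hom_u i) (u_neq0 i) (@sub i) w.
    by rewrite cE => tE; exists t.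
  have [t Ht] := choice restr.
  have Wt i : stanley_space (u i) (c i).2 (t i) by have [] := Ht i.
  have tE i p : (rep (t i))@_p = if in_cell (c i) p then (rep w)@_p else 0.
    by have [_ ->] := Ht i.
  exists [ffun i => t i]; split=> [|t' [Wt' wE]].
    split=> [i|]; first by rewrite ffunE.
    apply: rep_eqP => p Pp; rewrite rep_sum raddf_sum /=.
    have := sumE p; rewrite [P p]Pp => sum1.
    under eq_bigr do rewrite ffunE tE -mulrb -mulr_natr.
    by rewrite -mulr_sumr -natr_sum sum1 mulr1.
  apply/ffunP => i; rewrite ffunE; apply: rep_eqP => p _; rewrite tE.
  have out k : ~~ in_cell (c k) p -> (rep (t' k))@_p = 0.
    by rewrite -cE; apply: mcoeff_stanley_space.
  case: ifPn => [ci|/out //]; rewrite wE rep_sum raddf_sum /= (bigD1 i) //=.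
  rewrite big1 ?addr0 // => k neq_k; apply: out.
  by apply: contra neq_k => ck; apply/eqP/(cell_uniq _ _ _ ck ci).
exists (StanleyDecomposition hom_u
  (fun i => free_stanley_space (hom_u i) (u_neq0 i) (@sub i)) direct_u).
by move=> i /=; apply: s_ge; apply: mem_tnth.
Qed.

Lemma sdepth_cellP d : enat_le (Some d) (sdepth Mdeg) <->
  d = 0%N \/ cell_depth_ge d P.
Proof.
rewrite sdepth_geP; split=> -[->|H]; try by left.
  by right; apply: stanley_decomposition_cells.
by right; apply: cells_stanley_decomposition.
Qed.

End MonomialModule.

Lemma sdepth_le_root (K : fieldType) (n : nat) (M N : lmodType {mpoly K[n]})
    (Mdeg : ('I_n -> int) -> M -> Prop) (Ndeg : ('I_n -> int) -> N -> Prop)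
    (P Q : pred 'X_{1..n}) repM repN k :
  monomial_module Mdeg P repM -> monomial_module Ndeg Q repN ->
  (0 < k)%N -> (forall p, Q p = P (p *+ k)%MM) ->
  enat_le (sdepth Mdeg) (sdepth Ndeg).
Proof.
move=> HM HN k_gt0 QE; apply: enat_leP => d /(sdepth_cellP HM)[->|Pd].
  by apply/(sdepth_cellP HN); left.
by apply/(sdepth_cellP HN); right; apply: cell_depth_ge_root QE Pd.
Qed.

(** * Monomial ideals and their quotient rings as monomial modules *)

Section IdealsAndQuotients.
Variables (K : fieldType) (n : nat) (J : ideal {mpoly K[n]}).
Hypothesis monJ : monomially_closed J.

Lemma mem_monomially_closed (f : {mpoly K[n]}) :
  {subset msupp f <= [pred m | 'X_[m] \in J]} -> f \in J.
Proof.
move=> fJ; rewrite [f]mpolyE big_seq; apply: (@rpred_sum _ J) => m /fJ Jm.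
by rewrite -mul_mpolyC; apply: idealMl.
Qed.

Lemma submod_monomial_module :
  monomial_module (fun a (u : submod J) => zn_deg a (val u))
    (fun m => 'X_[m] \in J) (fun u : submod J => val u : {mpoly K[n]}).
Proof.
split=> [//| |f fJ|u m|//|//]; first exact: val_inj.
  by exists (Submod (mem_monomially_closed fJ)).
exact: monJ (valP u) m.
Qed.

(** The normal form modulo J, which makes the model of S/J independent of the representative chosen
    by [repr]. *)
Definition standard_part (f : {mpoly K[n]}) : {mpoly K[n]} :=
  \sum_(m <- msupp f | 'X_[m] \notin J) f@_m *: 'X_[m].

Lemma mcoeff_standard_part f m :
  (standard_part f)@_m = if 'X_[m] \in J then 0 else f@_m.
Proof.
rewrite raddf_sum /=; under eq_bigr do rewrite mcoeffZ mcoeffX.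
case: ifPn => Jm.
  rewrite big1 // => p; case: eqP => [-> |_ _]; last by rewrite mulr0.
  by rewrite Jm.
have [fm|fm] := boolP (m \in msupp f).
  rewrite -big_filter (bigD1_seq m) ?filter_uniq ?msupp_uniq ?mem_filter ?Jm //=.
  by rewrite eqxx mulr1 big1 ?addr0 // => p /negPf ->; rewrite mulr0.
rewrite (memN_msupp_eq0 fm) big1_seq // => p /andP[_ fp].
by case: eqP fp fm => [->|_]; [move=> ->|rewrite mulr0].
Qed.

Lemma sub_standard_part f : f - standard_part f \in J.
Proof.
apply: mem_monomially_closed => m; rewrite mcoeff_msupp mcoeffB inE.
by rewrite mcoeff_standard_part; case: ifP; rewrite // subrr eqxx.
Qed.

Lemma standard_part_eq f g : f - g \in J -> standard_part f = standard_part g.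
Proof.
move=> Jfg; apply/mpolyP => m; rewrite !mcoeff_standard_part.
case: ifPn => // Jm; apply/eqP; rewrite -subr_eq0 -mcoeffB; apply/eqP.
by apply: memN_msupp_eq0; apply: contra Jm; apply: monJ.
Qed.

Lemma quotmod_monomial_module :
  monomial_module
    (fun a (q : quotmod J) => exists2 f, zn_deg a f & q = quotmod_pi J f)
    (fun m => 'X_[m] \notin J) (fun q : quotmod J => standard_part (repr q)).
Proof.
have reprE f : standard_part (repr (quotmod_pi J f)) = standard_part f.
  by apply/standard_part_eq/quotmod_piE; rewrite quotmod_piK.
have piE (q : quotmod J) : quotmod_pi J (standard_part (repr q)) = q.
  transitivity (quotmod_pi J (repr q)); last exact: quotmod_piK.
  by apply/esym/quotmod_piE/sub_standard_part.
split=> [p q|p q eq_pq|f fJ|q m|a q m Jm|a q].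
- rewrite -[p](@quotmod_piK _ _ J) -[q](@quotmod_piK _ _ J) -quotmod_piD !reprE.
  apply/mpolyP => m; rewrite mcoeffD !mcoeff_standard_part mcoeffD.
  by case: ifP; rewrite ?addr0.
- by rewrite -[p]piE eq_pq piE.
- exists (quotmod_pi J f); rewrite reprE; apply/mpolyP => m.
  rewrite mcoeff_standard_part; case: ifPn => // Jm.
  by apply/esym/memN_msupp_eq0/negP => /fJ; rewrite -topredE /= Jm.
- rewrite mcoeff_msupp mcoeff_standard_part.
  by case: ifPn => [_|Jm _]; [rewrite eqxx|exact: Jm].
(* Multiplying [repr q] or its standard part by [a] gives results that differ by an element of J,
   which has no term at [m] outside J. *)
- rewrite -[a *: q]/(quotmod_pi J (a *: repr q)) reprE mcoeff_standard_part.
  have {}Jm : 'X_[m] \notin J := Jm; rewrite (negPf Jm).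
  apply/eqP; rewrite -subr_eq0 -mcoeffB -mulrBr; apply/eqP.
  apply: memN_msupp_eq0; apply: contra Jm; apply: monJ.
  exact/idealMl/sub_standard_part.
split=> [[f deg_f ->] m|deg_q]; last by exists (standard_part (repr q)).
rewrite reprE mcoeff_msupp mcoeff_standard_part; case: ifP; rewrite ?eqxx // => _.
by rewrite -mcoeff_msupp; apply: deg_f.
Qed.

End IdealsAndQuotients.

Local Close Scope ring_scope.

Theorem corollary2p10 (K : fieldType) (n : nat) (I : ideal {mpoly K[n]}) :
  monomial_ideal I ->
  exists k1 k2 : nat,
    (1 <= k1)%N /\ (1 <= k2)%N /\
    forall s : nat, (1 <= s)%N ->
      enat_le (sdepth_ideal (ideal_pow I (s * k1)))
              (sdepth_ideal (integral_closure I)) /\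
      enat_le (sdepth_quotient (ideal_pow I (s * k2)))
              (sdepth_quotient (integral_closure I)).
Proof.
move=> /monomial_ideal_closed monI.
have [k k_gt0 kE] := integral_closure_exponent monI.
(* One exponent serves both inequalities, since negating the equivalence [kE] gives the one for the
   complements. *)
exists k, k; split=> //; split=> // s s_gt0.
have sk_gt0 : (0 < s * k)%N by rewrite muln_gt0 s_gt0.
have mon_pow := ideal_pow_monomially_closed (k := s * k) monI.
have mon_cl := integral_closure_monomially_closed monI.
split.
  apply: (sdepth_le_root (submod_monomial_module mon_pow)
    (submod_monomial_module mon_cl) sk_gt0) => p /=.
  exact: kE.
apply: (sdepth_le_root (quotmod_monomial_module mon_pow)
  (quotmod_monomial_module mon_cl) sk_gt0) => p /=.
by congr (~~ _); apply: kE.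
Qed.
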